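(* Let $H=H_1\times\dots\times H_n$ where $n\in\mathbb N$ and $H_1,\dots,H_n$ are atomic monoids. Then the following statements are equivalent: (a) $H$ satisfies the Structure Theorem for Sets of Lengths, $\mathsf c_{\mathrm{eq}}(H)<\infty$, and $\delta_w(H)<\infty$. (b) For every $i\in[1,n]$, $H_i$ satisfies the Structure Theorem for Sets of Lengths, $\mathsf c_{\mathrm{eq}}(H_i)<\infty$, and $\delta_w(H_i)<\infty$.
   Context: A monoid is a commutative semigroup $H$ with identity which is unit-cancellative: $a=au$ with $a,u\in H$ implies $u\in H^\times$ (the group of invertible elements). $H_{\mathrm{red}}=\{aH^\times\mid a\in H\}$. An element $u\in H\setminus H^\times$ is an atom if $u=ab$ implies $a\in H^\times$ or $b\in H^\times$; $H$ is atomic if every non-unit is a finite product of atoms. For atomic $H$: $\mathsf Z(H)$ is the free abelian monoid on the atoms of $H_{\mathrm{red}}$, $|z|$ is the length (number of factors with multiplicity) of $z\in\mathsf Z(H)$, $\pi:\mathsf Z(H)\to H_{\mathrm{red}}$ is the canonical homomorphism, $\mathsf Z(a)=\pi^{-1}(aH^\times)$, $\mathsf Z_k(a)=\{z\in\mathsf Z(a)\mid|z|=k\}$, $\mathsf L(a)=\{|z|\mid z\in\mathsf Z(a)\}$. $\mathsf d(z,z')=\max\{|zg^{-1}|,|z'g^{-1}|\}$ with $g=\gcd(z,z')$; for nonempty sets $\mathsf d(X,Y)=\min\{\mathsf d(x,y)\mid x\in X,y\in Y\}$. The equal catenary degree $\mathsf c_{\mathrm{eq}}(H)$ is the smallest $N\in\mathbb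 N_0\cup\{\infty\}$ such that for all $a\in H$ and all $z,z'\in\mathsf Z(a)$ with $|z|=|z'|$ there are $z=z_0,\dots,z_k=z'$ in $\mathsf Z(a)$ with $\mathsf d(z_{i-1},z_i)\le N$ for all $i$ and $|z_0|\le\dots\le|z_k|$ or $|z_0|\ge\dots\ge|z_k|$ (hence all lengths equal). The weak successive distance $\delta_w(H)$ is the smallest $N\in\mathbb N_0\cup\{\infty\}$ such that $\mathsf d(\mathsf Z_k(a),\mathsf Z_\ell(a))\le N|\ell-k|$ for all $a\in H$ and $k,\ell\in\mathsf L(a)$. For $d\in\mathbb N$, $M\in\mathbb N_0$, $\{0,d\}\subset\mathcal D\subset[0,d]$ (integer interval), a set $L\subset\mathbb Z$ is an AAMP with difference $d$, period $\mathcal D$ and bound $M$ if $L=y+(L'\cup L^*\cup L'')\subset y+\mathcal D+d\mathbb Z$ where $y\in\mathbb Z$, $L^*$ is finite nonempty with $\min L^*=0$ and $L^*=(\mathcal D+d\mathbb Z)\cap[0,\max L^*]$, $L'\subset[-M,-1]$, $L''\subset\max L^*+[1,M]$. The Structure Theorem for Sets of Lengths holds for $H$ if $H$ is atomic and there are $M\in\mathbb N_0$ and a finite nonempty $\Delta\subset\mathbb N$ such that for every $a\in H$, $\mathsf L(a)$ is an AAMP with some difference $d\in\Delta$ and bound $M$. *)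

(* Defs.v *)
From HB Require Import structures.
From mathcomp Require Import all_boot all_order ssralg ssrnum ssrint.
From mathcomp Require Import finmap multiset.
From mathcomp Require Import boolp classical_sets cardinality.
Import Order.TTheory GRing.Theory Num.Theory.

Set Implicit Arguments.
Unset Strict Implicit.
Unset Printing Implicit Defensive.

Local Open Scope classical_set_scope.
Local Open Scope quotient_scope.
Local Open Scope group_scope.

(* The factorization-theoretic notion of monoid: commutative, and a = a u
   forces u to be invertible. *)
HB.mixin Record Monoid_isUnitCancellative M of Monoid M := {
  ucmulC : forall a b : M, a * b = b * a ;
  unit_cancel : forall a u : M, a = a * u -> exists v, u * v = 1
}.

#[short(type="ucMonoidType")]
HB.structure Definition UCMonoid :=
  {M of Monoid_isUnitCancellative M & Monoid M}.

Section Product.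
Variables (I : finType) (H : I -> ucMonoidType).

Definition prod_monoid := {dffun forall i : I, H i}.
HB.instance Definition _ := Choice.on prod_monoid.

Definition prod_mul (x y : prod_monoid) : prod_monoid :=
  [ffun i => x i * y i].
Definition prod_one : prod_monoid := [ffun i => 1].

Lemma prod_mulA : associative prod_mul.
Proof. by move=> x y z; apply/ffunP => i; rewrite !ffunE mulgA. Qed.

Lemma prod_mul1x : left_id prod_one prod_mul.
Proof. by move=> x; apply/ffunP => i; rewrite !ffunE mul1g. Qed.

Lemma prod_mulx1 : right_id prod_one prod_mul.
Proof. by move=> x; apply/ffunP => i; rewrite !ffunE mulg1. Qed.

HB.instance Definition _ :=
  isMonoid.Build prod_monoid prod_mulA prod_mul1x prod_mulx1.

Lemma prod_mulC (x y : prod_monoid) : x * y = y * x.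
Proof. by apply/ffunP => i; rewrite !ffunE ucmulC. Qed.

Lemma prod_unit_cancel (x u : prod_monoid) :
  x = x * u -> exists v : prod_monoid, u * v = 1.
Proof.
move=> xu.
have /fin_all_exists [v uv] (i : I) : exists w, u i * w = 1.
  by apply: (@unit_cancel _ (x i)); rewrite {1}xu ffunE.
by exists [ffun i => v i]; apply/ffunP => i; rewrite !ffunE uv.
Qed.

HB.instance Definition _ :=
  Monoid_isUnitCancellative.Build prod_monoid prod_mulC prod_unit_cancel.

End Product.

Section Units.
Variable H : ucMonoidType.
Implicit Types a b u : H.

Definition invertible a : Prop := exists b, a * b = 1.

Definition atom u : Prop :=
  ~ invertible u /\
  forall a b, u = a * b -> invertible a \/ invertible b.

Definition atomic : Prop :=
  forall a, ~ invertible a ->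
    exists2 s : seq H, (forall u, u \in s -> atom u) & a = \prod_(u <- s) u.

Lemma invertible1 : invertible 1.
Proof. by exists 1; rewrite mulg1. Qed.

Lemma invertibleM a b : invertible a -> invertible b -> invertible (a * b).
Proof.
move=> [a' aa'] [b' bb']; exists (b' * a').
by rewrite -mulgA (mulgA b) bb' mul1g.
Qed.

(* b \in a H^x, i.e. a H^x = b H^x *)
Definition assoc a b : bool := `[< exists2 u, invertible u & b = a * u >].

Lemma assoc_refl : reflexive assoc.
Proof.
by move=> a; apply/asboolP; exists 1; [exact: invertible1 | rewrite mulg1].
Qed.

Lemma assoc_imp a b : assoc a b -> assoc b a.
Proof.
move=> /asboolP[u [v uv] ->]; apply/asboolP; exists v; last first.
  by rewrite -mulgA uv mulg1.
by exists u; rewrite ucmulC.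
Qed.

Lemma assoc_sym : symmetric assoc.
Proof. by move=> a b; apply/idP/idP; exact: assoc_imp. Qed.

Lemma assoc_trans : transitive assoc.
Proof.
move=> b a c /asboolP[u uU ->] /asboolP[v vU ->]; apply/asboolP.
by exists (u * v); [exact: invertibleM | rewrite mulgA].
Qed.

Canonical assoc_equiv := EquivRel assoc assoc_refl assoc_sym assoc_trans.

End Units.

Section Reduced.
Variable H : ucMonoidType.

Definition red := {eq_quot (assoc_equiv H)}.
HB.instance Definition _ := Choice.on red.
HB.instance Definition _ := EqQuotient.on red.

Definition red_mul (x y : red) : red := \pi_red (repr x * repr y).
Definition red_one : red := \pi_red 1.

Lemma assocM (a b c d : H) : assoc a b -> assoc c d -> assoc (a * c) (b * d).
Proof.
move=> /asboolP[u uU ->] /asboolP[v vU ->]; apply/asboolP.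
exists (u * v); first exact: invertibleM.
by rewrite -!mulgA; congr (_ * _); rewrite !mulgA (ucmulC c).
Qed.

Lemma red_mul_pi (a b : H) : \pi_red (a * b) = red_mul (\pi_red a) (\pi_red b).
Proof.
by apply/eqmodP; apply: assocM; apply/eqmodP; rewrite reprK.
Qed.

Lemma red_mulA : associative red_mul.
Proof.
move=> x y z; rewrite -[x]reprK -[y]reprK -[z]reprK.
move: (repr x) (repr y) (repr z) => a b c.
by rewrite -(red_mul_pi b) -(red_mul_pi a b) -!red_mul_pi mulgA.
Qed.

Lemma red_mul1x : left_id red_one red_mul.
Proof. by move=> x; rewrite -[x]reprK /red_one -red_mul_pi mul1g. Qed.

Lemma red_mulx1 : right_id red_one red_mul.
Proof. by move=> x; rewrite -[x]reprK /red_one -red_mul_pi mulg1. Qed.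

HB.instance Definition _ := isMonoid.Build red red_mulA red_mul1x red_mulx1.

Lemma pi_redM (a b : H) : \pi_red (a * b) = \pi_red a * \pi_red b.
Proof. exact: red_mul_pi. Qed.

Lemma pi_red1 : \pi_red 1 = 1 :> red.
Proof. by []. Qed.

Lemma red_mulC (x y : red) : x * y = y * x.
Proof. by rewrite -[x]reprK -[y]reprK -!pi_redM ucmulC. Qed.

Lemma red_unit_cancel (x u : red) : x = x * u -> exists v : red, u * v = 1.
Proof.
rewrite -[x]reprK -[u]reprK -pi_redM.
move: (repr x) (repr u) => {x u} a b /eqmodP/asboolP[w [w' ww'] abw].
have /unit_cancel[v bv] : a = a * (b * w')
  by rewrite mulgA abw -mulgA ww' mulg1.
by exists (\pi_red (w' * v)); rewrite -pi_redM mulgA bv.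
Qed.

HB.instance Definition _ :=
  Monoid_isUnitCancellative.Build red red_mulC red_unit_cancel.

End Reduced.

(* Smallest element of A in N_0 + {oo}, where None stands for oo. *)
Definition least (A : set nat) : option nat :=
  if pselect (exists n, `[< A n >]) is left exA then Some (ex_minn exA)
  else None.

Section Factorizations.
Variable H : ucMonoidType.

Definition red_atom := {u : red H | `[< atom u >]}.
HB.instance Definition _ := Choice.on red_atom.

(* Z(H), the free abelian monoid on the atoms of H_red *)
Local Notation fact := {mset red_atom}%mset.
Implicit Types (a : H) (z : fact) (X Y : set fact) (k l N : nat).

Definition len z : nat := size z.
Definition fact_val z : red H := \prod_(u <- z) val u.

Definition facts a : set fact := [set z | fact_val z = \pi_(red H) a].
Definition facts_len k a : set fact := [set z | facts a z /\ len z = k].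
Definition lengths a : set nat := [set len z | z in facts a].

Definition dist z z' : nat :=
  let g := (z `&` z')%mset in
  maxn (len (z `\` g)%mset) (len (z' `\` g)%mset).

(* Minimal distance; only meaningful for nonempty X and Y. *)
Definition set_dist X Y : nat :=
  odflt 0 (least [set n | exists x y, [/\ X x, Y y & dist x y = n]]).

(* The chain z = z_0, z_1, ..., z_k = z' is z :: s, so s may be empty. *)
Definition monotone_chain N a z z' : Prop :=
  exists s : seq fact,
    [/\ forall x, x \in z :: s -> facts a x,
        last z s = z',
        path (fun x y => dist x y <= N)%N z s
      & sorted leq [seq len x | x <- z :: s]
        \/ sorted geq [seq len x | x <- z :: s]].

Definition equal_catenary_degree : option nat :=
  least [set N | forall a z z', facts a z -> facts a z' -> len z = len z' ->
                   monotone_chain N a z z'].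

Definition weak_successive_distance : option nat :=
  least [set N | forall a k l, lengths a k -> lengths a l ->
    (set_dist (facts_len k a) (facts_len l a) <= N * absz (l%:Z - k%:Z)%R)%N].

End Factorizations.

Local Open Scope ring_scope.

(* D + dZ *)
Definition periodic_set (d : nat) (D : set int) : set int :=
  [set x | exists2 t, D t & exists q : int, x = t + d%:Z * q].

Definition translate (y : int) (L : set int) : set int := [set y + x | x in L].

Definition is_AAMP (d M : nat) (D L : set int) : Prop :=
  [/\ (0 < d)%N, D 0, D d%:Z & D `<=` [set x | 0 <= x <= d%:Z]] /\
  exists (y : int) (L1 Ls L2 : set int) (m : int),
    [/\ L = translate y (L1 `|` Ls `|` L2),
        L `<=` translate y (periodic_set d D)
      & [/\ finite_set Ls,
            (Ls 0 /\ forall x, Ls x -> 0 <= x),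
            (Ls m /\ forall x, Ls x -> x <= m)
          & Ls = periodic_set d D `&` [set x | 0 <= x <= m]]] /\
    L1 `<=` [set x | - M%:Z <= x <= -1] /\
    L2 `<=` [set x | m + 1 <= x <= m + M%:Z].

Definition structure_theorem (H : ucMonoidType) : Prop :=
  atomic H /\
  exists (M : nat) (Delta : set nat),
    [/\ finite_set Delta, Delta !=set0, (forall d, Delta d -> (0 < d)%N)
      & forall a : H, exists2 d, Delta d &
          exists D : set int, is_AAMP d M D [set k%:Z | k in lengths a]].

(* Main.v *)
Require Import Defs.
From HB Require Import structures.
From mathcomp Require Import all_boot all_order ssralg ssrnum ssrint intdiv.
From mathcomp Require Import finmap multiset.
From mathcomp Require Import boolp classical_sets cardinality.
From mathcomp Require Import zify ring.

(** For one direction, each [H i] embeds in the product as a divisor-closed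
    factor, so everything restricts.  For the other, the atoms of the reduced
    product are those of the reduced factors, so a factorization in the product
    is a family of factorizations and length sets add up.  Sumsets of AAMPs are
    AAMPs: a common difference is the product of all the differences, and a
    short summand only changes the period of a long one.

    For the two distances let [k] and [l] be vectors of lengths of the factors.
    If [l i] is far above [k i] and [l j] far below [k j], then a fixed multiple
    of the common difference can be moved from [l i] to [l j]: the new entries
    lie in the same residue class and in the periodic part of the length sets.
    This preserves the sum and brings [l] closer to [k].  Once no such pair is
    left, the l1-distance of [k] and [l] is bounded up to the difference of
    their sums, and [delta_w] and [c_eq] of the factors realize the remaining
    jump. *)

Set Implicit Arguments.
Unset Strict Implicit.
Unset Printing Implicit Defensive.
Import Order.TTheory GRing.Theory Num.Theory.

Local Open Scope classical_set_scope.
Local Open Scope nat_scope.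

(** Registered so that products over multisets may be reordered and split. *)
HB.instance Definition _ (G : ucMonoidType) :=
  SemiGroup.isCommutativeLaw.Build G *%g (@ucmulC G).

(** * Reduced monoids and factorizations in a product *)

Section Reduced.
Local Open Scope group_scope.
Local Open Scope quotient_scope.
Variable H : ucMonoidType.
Implicit Types (a b : H) (x y : red H).

Lemma pi_redP a b : (\pi_(red H) a = \pi_(red H) b) <-> assoc a b.
Proof. by split=> [/eqmodP|ab]; last apply/eqmodP. Qed.

Lemma pi_red_eq1 a : \pi_(red H) a = 1 <-> invertible a.
Proof.
rewrite -pi_red1 pi_redP; split.
  by rewrite assoc_sym => /asboolP[u uU ->]; rewrite mul1g.
by move=> [b ab]; apply/asboolP; exists b => //; exists a; rewrite ucmulC.
Qed.

Lemma red_mul_eq1 x y : x * y = 1 -> x = 1.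
Proof.
rewrite -[x]reprK -[y]reprK -pi_redM => /pi_red_eq1 [c abc].
by apply/pi_red_eq1; exists (repr y * c); rewrite mulgA.
Qed.

Lemma red_invertibleP x : invertible x <-> x = 1.
Proof.
split=> [[y /red_mul_eq1]//|->]; exact: invertible1.
Qed.

Lemma red_atomP x :
  atom x <-> x <> 1 /\ forall y z, x = y * z -> y = 1 \/ z = 1.
Proof.
rewrite /atom red_invertibleP.
by split=> -[x1 h]; split=> // y z /h; rewrite !red_invertibleP.
Qed.

Lemma atom_repr x : atom x -> atom (repr x).
Proof.
move=> /red_atomP[x1 xA]; split.
  by move=> /pi_red_eq1; rewrite reprK.
move=> a b xab; have /xA : x = \pi_(red H) a * \pi_(red H) b.
  by rewrite -pi_redM -xab reprK.
by rewrite !pi_red_eq1.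
Qed.

Lemma atomMunit a u : atom a -> invertible u -> atom (a * u).
Proof.
move=> [aU aA] [v uv]; split.
  by move=> [c auc]; apply: aU; exists (u * c); rewrite mulgA.
move=> b c e; have : a = b * (c * v) by rewrite mulgA -e -mulgA uv mulg1.
move=> /aA[|[w cvw]]; first by left.
by right; exists (v * w); rewrite mulgA.
Qed.

Lemma pi_red_prod (s : seq H) :
  \pi_(red H) (\prod_(u <- s) u) = \prod_(u <- s) \pi_(red H) u.
Proof.
by elim: s => [|u s IHs]; rewrite ?big_nil ?pi_red1// !big_cons pi_redM IHs.
Qed.

(** Representatives of the atoms of a factorization multiply to [a] only up to a unit. That unit is
    absorbed into the first atom; with no atom present, [a] itself would be invertible. *)
Lemma atomic_of_facts : (forall a, exists z, facts a z) -> atomic H.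
Proof.
move=> Hf a aU; have [z] := Hf a; rewrite /facts/= /fact_val => zP.
pose s := [seq repr (val u) | u : red_atom H <- z].
have sA u : u \in s -> atom u.
  by move=> /mapP[v _ ->]; apply: atom_repr; apply/asboolP; exact: (valP v).
have : \pi_(red H) (\prod_(u <- s) u) = \pi_(red H) a.
  by rewrite pi_red_prod -zP big_map; apply: eq_bigr => u _; rewrite reprK.
move=> /pi_redP/asboolP[u uU].
case: s sA => [|b s] sA eqa.
  by case: aU; rewrite eqa big_nil mul1g.
exists (b * u :: s).
  move=> c; rewrite inE => /predU1P[->|cs].
    by apply: atomMunit => //; apply: sA; rewrite mem_head.
  by apply: sA; rewrite inE cs orbT.
by rewrite eqa !big_cons -!mulgA (ucmulC u).
Qed.

End Reduced.

(** * Atoms and factorizations of the reduced product *)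

Section ProductReduced.
Local Open Scope group_scope.
Local Open Scope quotient_scope.
Variables (I : finType) (H : I -> ucMonoidType).
Local Notation P := (prod_monoid H).
Implicit Types (a b : P) (x y : red P) (i j : I).

Lemma prod_mulE a b i : (a * b) i = a i * b i.
Proof. by rewrite ffunE. Qed.

Lemma prod_oneE i : (1 : P) i = 1.
Proof. by rewrite ffunE. Qed.

Lemma prod_assocP a b : assoc a b <-> forall i, assoc (a i) (b i).
Proof.
split=> [/asboolP[u [v uv] ->] i|ab].
  apply/asboolP; exists (u i); last by rewrite prod_mulE.
  by exists (v i); rewrite -prod_mulE uv prod_oneE.
have /fin_all_exists [u uP] i : exists u,
    invertible u /\ b i = a i * u.
  by have /asboolP[u ? ?] := ab i; exists u.
have /fin_all_exists [v vP] i : exists v, u i * v = 1 by case: (uP i).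
apply/asboolP; exists ([ffun i => u i] : P).
  exists ([ffun i => v i] : P); apply/ffunP => i.
  by rewrite prod_mulE !ffunE vP.
by apply/ffunP => i; rewrite prod_mulE !ffunE; case: (uP i).
Qed.

Definition red_proj i x : red (H i) := \pi_(red (H i)) ((repr x) i).

Lemma red_proj_pi i a : red_proj i (\pi_(red P) a) = \pi_(red (H i)) (a i).
Proof.
apply/pi_redP; move: i; apply/prod_assocP; apply/pi_redP.
by rewrite reprK.
Qed.

Lemma red_projM i x y : red_proj i (x * y) = red_proj i x * red_proj i y.
Proof.
by rewrite -[x]reprK -[y]reprK -pi_redM !red_proj_pi prod_mulE pi_redM.
Qed.

Lemma red_proj1 i : red_proj i 1 = 1.
Proof. by rewrite -pi_red1 red_proj_pi prod_oneE pi_red1. Qed.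

Lemma red_proj_inj x y : (forall i, red_proj i x = red_proj i y) -> x = y.
Proof.
rewrite -[x]reprK -[y]reprK => xy; apply/pi_redP/prod_assocP => i.
by apply/pi_redP; have := xy i; rewrite !red_proj_pi.
Qed.

Definition red_glue (x : forall i, red (H i)) : red P :=
  \pi_(red P) [ffun i => repr (x i)].

Lemma red_glueK (x : forall i, red (H i)) i : red_proj i (red_glue x) = x i.
Proof. by rewrite red_proj_pi ffunE reprK. Qed.

Definition red_inj i (u : red (H i)) : red P :=
  red_glue (dfwith (fun j => 1 : red (H j)) u).

Lemma red_proj_inj_id i (u : red (H i)) : red_proj i (red_inj u) = u.
Proof. by rewrite red_glueK dfwith_in. Qed.

Lemma red_proj_inj_neq i j (u : red (H i)) :
  i != j -> red_proj j (red_inj u) = 1.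
Proof. by move=> ij; rewrite red_glueK dfwith_out. Qed.

Lemma red_inj_atom i (u : red (H i)) : atom u -> atom (red_inj u).
Proof.
move=> /red_atomP[u1 uA]; apply/red_atomP; split.
  by move=> /(congr1 (red_proj i)); rewrite red_proj_inj_id red_proj1.
move=> x y xy.
have one j : i != j -> red_proj j x = 1 /\ red_proj j y = 1.
  move=> /red_proj_inj_neq => /(_ u); rewrite xy red_projM => xy1.
  split; first exact: red_mul_eq1 xy1.
  by apply: red_mul_eq1; rewrite ucmulC; exact: xy1.
have : u = red_proj i x * red_proj i y.
  by rewrite -red_projM -xy red_proj_inj_id.
move=> /uA[] e; [left|right]; apply: red_proj_inj => j; rewrite red_proj1;
  by have [<-|/one[]] := eqVneq i j.
Qed.

(** Every [x] is its [i]-th component times the rest. For an atom with nontrivial [i]-th component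
    the rest must be 1, and any splitting of that component lifts to a splitting of [x]. *)
Lemma atom_red_inj x i : atom x -> red_proj i x <> 1 ->
  x = red_inj (red_proj i x) /\ atom (red_proj i x).
Proof.
move=> /red_atomP[x1 xA] xi1.
have ex : x = red_inj (red_proj i x) *
    red_glue (dfwith (fun j => red_proj j x) (1 : red (H i))).
  apply: red_proj_inj => j; rewrite red_projM red_glueK.
  have [<-|ij] := eqVneq i j.
    by rewrite red_proj_inj_id dfwith_in mulg1.
  by rewrite red_proj_inj_neq// dfwith_out// mul1g.
have e : x = red_inj (red_proj i x).
  have /xA[xi|e] := ex; last by rewrite {1}ex e mulg1.
  by case: xi1; rewrite -[LHS]red_proj_inj_id xi red_proj1.
split=> //; apply/red_atomP; split=> // u v uv.
have /xA xuv : x = red_inj u * red_inj v.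
  rewrite e; apply: red_proj_inj => j; rewrite red_projM.
  have [<-|ij] := eqVneq i j; first by rewrite !red_proj_inj_id.
  by rewrite !red_proj_inj_neq// mulg1.
rewrite -[u]red_proj_inj_id -[v]red_proj_inj_id.
by case: xuv => ->; rewrite red_proj1; [left|right].
Qed.


Local Notation fact K := {mset (red_atom K)}%mset.
Implicit Type z : fact P.

Lemma val_atom (K : ucMonoidType) (u : red_atom K) : atom (val u).
Proof. by apply/asboolP; exact: (valP u). Qed.

Definition atom_inj i (u : red_atom (H i)) : red_atom P :=
  Sub (red_inj (val u)) (introT (asboolP _) (red_inj_atom (val_atom u))).

(** The value is [None] exactly when the [i]-th component of [y] is 1, that is, when [y] belongs to
    another factor. *)
Definition atom_proj i (y : red_atom P) : option (red_atom (H i)) :=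
  insub (red_proj i (val y)).

Lemma atom_projK i (u : red_atom (H i)) (y : red_atom P) :
  (atom_proj i y == Some u) = (y == atom_inj u).
Proof.
apply/eqP/eqP => [|->]; last first.
  rewrite /atom_proj SubK red_proj_inj_id.
  exact: valK.
rewrite /atom_proj; case: insubP => // v _ vy [vu].
apply: val_inj; rewrite SubK -vu vy.
have [|//] := @atom_red_inj (val y) i (val_atom y).
by rewrite -vy; have /red_atomP[] := val_atom v.
Qed.

Lemma atom_proj_val i (y : red_atom P) :
  red_proj i (val y) = oapp val 1 (atom_proj i y).
Proof.
have [e|/eqP ne] := eqVneq (red_proj i (val y)) 1.
  rewrite e /atom_proj insubF ?e//; apply/negbTE/negP => /asboolP/red_atomP[].
  by [].
have [_ yA] := atom_red_inj (val_atom y) ne.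
by rewrite /atom_proj insubT//=; apply/asboolP.
Qed.

Lemma atom_proj_ex (y : red_atom P) :
  exists i (u : red_atom (H i)), y = atom_inj u.
Proof.
have [i yi] : exists i, red_proj i (val y) <> 1.
  apply/existsNP => y1; have /red_atomP[+ _] := val_atom y; apply.
  by apply: red_proj_inj => i; rewrite y1 red_proj1.
move: yi; rewrite atom_proj_val.
case e: (atom_proj i y) => [u|//] _; exists i, u.
by apply/eqP; rewrite -atom_projK e.
Qed.

Lemma atom_proj_neq i j (u : red_atom (H i)) :
  i != j -> atom_proj j (atom_inj u) = None.
Proof.
move=> ij; rewrite /atom_proj SubK red_proj_inj_neq// insubF//.
by apply/negbTE/negP => /asboolP/red_atomP[].
Qed.

(** Each atom of the product belongs to exactly one factor; this makes lengths additive. *)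
Lemma atom_proj_size (y : red_atom P) : (\sum_i (atom_proj i y : bool) = 1)%N.
Proof.
have [i [u ->]] := atom_proj_ex y.
rewrite (bigD1 i)//= big1 ?addn0; last first.
  by move=> j ji; rewrite atom_proj_neq// eq_sym.
by have := eqxx (atom_inj u); rewrite -atom_projK => /eqP ->.
Qed.

Definition fact_proj i z : fact (H i) := seq_mset (pmap (@atom_proj i) z).

(** Describing the projection by multiplicities lets it commute with gcd and cancellation, which are
    computed multiplicity by multiplicity. *)
Lemma fact_projE i z (u : red_atom (H i)) : fact_proj i z u = z (atom_inj u).
Proof.
rewrite mset_seqE -(count_mem_mset _ z).
elim: (z : seq _) => //= y s IHs; rewrite -IHs -atom_projK.
by case: (atom_proj i y).
Qed.

Lemma fact_proj_inj z z' : (forall i, fact_proj i z = fact_proj i z') -> z = z'.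
Proof.
move=> zz'; apply/msetP => y; have [i [u ->]] := atom_proj_ex y.
by rewrite -!fact_projE zz'.
Qed.

Definition fact_glue (f : forall i, fact (H i)) : fact P :=
  seq_mset (flatten [seq map (@atom_inj i) (f i) | i <- enum I]).

Lemma fact_glueK f i : fact_proj i (fact_glue f) = f i.
Proof.
apply/msetP => u; rewrite fact_projE mset_seqE count_flatten sumn_map big_map.
(* Only the block of index [i] contains copies of [atom_inj u]. *)
rewrite big_enum/= (bigD1 i)//= big1 => [|j ji]; rewrite count_map.
  rewrite addn0 -(count_mem_mset u); apply: eq_count => v /=.
  have := atom_projK u (atom_inj v).
  by have := atom_projK v (atom_inj v); rewrite eqxx => /eqP -> <-.
rewrite -[RHS](count_pred0 (f j)); apply: eq_count => v /=.
by rewrite -atom_projK atom_proj_neq.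
Qed.

Lemma len_proj z : len z = (\sum_i len (fact_proj i z))%N.
Proof.
transitivity (\sum_i size (pmap (@atom_proj i) z))%N; last first.
  by apply: eq_bigr => i _; rewrite /len (perm_size (perm_eq_seq_mset _)).
rewrite /len; elim: (z : seq _) => /= [|y s IHs]; first by rewrite big1.
rewrite -add1n -(atom_proj_size y) IHs -big_split/=.
by apply: eq_bigr => i _; case: (atom_proj i y).
Qed.

Lemma red_proj_fact_val i z :
  red_proj i (fact_val z) = fact_val (fact_proj i z).
Proof.
rewrite /fact_val.
transitivity (\prod_(u <- pmap (@atom_proj i) z) val u); last first.
  by apply: perm_big; rewrite perm_sym perm_eq_seq_mset.
elim: (z : seq _) => [|y s IHs]; first by rewrite !big_nil red_proj1.
rewrite big_cons red_projM IHs atom_proj_val /=.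
by case: (atom_proj i y) => [u|] /=; rewrite ?big_cons ?mul1g.
Qed.

Lemma facts_proj a z : facts a z <-> forall i, facts (a i) (fact_proj i z).
Proof.
rewrite /facts/=; split=> [za i|za].
  by rewrite -red_proj_fact_val za red_proj_pi.
by apply: red_proj_inj => i; rewrite red_proj_fact_val za red_proj_pi.
Qed.

Lemma fact_projI i z z' :
  fact_proj i (z `&` z')%mset = (fact_proj i z `&` fact_proj i z')%mset.
Proof. by apply/msetP => u; rewrite !(msetE2, fact_projE). Qed.

Lemma fact_projB i z z' :
  fact_proj i (z `\` z')%mset = (fact_proj i z `\` fact_proj i z')%mset.
Proof. by apply/msetP => u; rewrite !(msetE2, fact_projE). Qed.

(** Projection commutes with removing the gcd and never increases length. *)
Lemma dist_proj_le i z z' :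
  (dist (fact_proj i z) (fact_proj i z') <= dist z z')%N.
Proof.
have le_len w : (len (fact_proj i w) <= len w)%N.
  by rewrite [len w]len_proj (bigD1 i)//= leq_addr.
by rewrite /dist -fact_projI -!fact_projB geq_max !leq_max !le_len orbT.
Qed.

(** A maximum of two sums is at most the sum of the maxima. *)
Lemma dist_le_sum z z' :
  (dist z z' <= \sum_i dist (fact_proj i z) (fact_proj i z'))%N.
Proof.
rewrite {1}/dist geq_max !len_proj; apply/andP; split; apply: leq_sum => i _;
  by rewrite fact_projB fact_projI leq_max leqnn ?orbT.
Qed.

End ProductReduced.

(** * Sumsets of AAMPs *)

Section IntegerSets.
Local Open Scope ring_scope.

Lemma int_min (A : set int) (b : int) :
  A !=set0 -> (forall x, A x -> b <= x) ->
  exists2 m, A m & forall x, A x -> m <= x.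
Proof.
move=> [x0 Ax0] bA.
have exA : exists n, `[< A (b + n%:Z) >].
  exists `|x0 - b|%N; apply/asboolP; have := bA _ Ax0 => bx0.
  by rewrite (_ : b + _ = x0)//; lia.
exists (b + (ex_minn exA)%:Z); case: ex_minnP => n /asboolP// An nmin x Ax.
have := bA _ Ax => bx.
have : (n <= `|x - b|%N)%N.
  by apply: nmin; apply/asboolP; rewrite (_ : b + _ = x)//; lia.
by lia.
Qed.

Lemma int_max (A : set int) (b : int) :
  A !=set0 -> (forall x, A x -> x <= b) ->
  exists2 m, A m & forall x, A x -> x <= m.
Proof.
move=> [x0 Ax0] Ab.
have [||m Am mmin] := @int_min [set x | A (- x)] (- b).
- by exists (- x0); rewrite /= opprK.
- by move=> x /Ab; lia.
exists (- m) => // x Ax; have := mmin (- x); rewrite /= opprK => /(_ Ax).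
by lia.
Qed.

(** Any window of [d] consecutive integers meets the residue class of [x]. *)
Lemma int_shift (d : nat) (x u : int) : (0 < d)%N ->
  exists q : int, u <= x + d%:Z * q < u + d%:Z.
Proof.
move=> d0; exists (- ((x - u) %/ d%:Z)%Z).
have := divz_eq (x - u) d%:Z.
have := modz_ge0 (x - u) (_ : d%:Z != 0) => /(_ _)/wrap[]; first by lia.
have := ltz_pmod (x - u) (_ : 0 < d%:Z) => /(_ _)/wrap[]; first by lia.
move: ((x - u) %% d)%Z ((x - u) %/ d)%Z => r q.
rewrite mulrN (mulrC d%:Z); lia.
Qed.

(* An AAMP in which the central part need not start and end in the set;
   [P] plays the role of [y + D + dZ].  This form is equivalent to [is_AAMP]
   up to enlarging [M], and [P `&` [u, v]] may be empty (even [v < u]), which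
   covers the sets that are too short to show the period. *)
Definition loose (d M : nat) (L : set int) : Prop :=
  L !=set0 /\ exists (P : set int) (u v : int),
    [/\ forall x q, P x -> P (x + d%:Z * q),
        forall x, L x -> P x /\ u - M%:Z <= x <= v + M%:Z
      & forall x, P x -> u <= x <= v -> L x].

Lemma loose_monotone (d M N : nat) L : (M <= N)%N -> loose d M L -> loose d N L.
Proof.
move=> MN [L0 [P [u [v [Pd LP PL]]]]]; split=> //; exists P, u, v; split=> //.
by move=> x /LP[Px ux]; split=> //; lia.
Qed.

Lemma loose_dvdn (d d' M : nat) L : (d %| d')%N -> loose d M L -> loose d' M L.
Proof.
move=> /dvdnP[c ->] [L0 [P [u [v [Pd LP PL]]]]]; split=> //.
exists P, u, v; split=> // x q Px.
by rewrite (_ : _ * q = d%:Z * (c%:Z * q)); [exact: Pd | rewrite PoszM; ring].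
Qed.

Lemma loose_of_AAMP (d M : nat) D L : is_AAMP d M D L -> loose d M L.
Proof.
move=> [_ [y [L1 [Ls [L2 [m [AL]]]]]]] [L1M L2M].
have [eL LP [_ [Ls0 _] [Lsm Lsle] eLs]] := AL.
split.
  by exists (y + 0); rewrite eL; exists 0 => //; left; right.
exists (translate y (periodic_set d D)), y, (y + m); split.
- move=> _ q [_ [t Dt [k ->]] <-]; exists (t + d%:Z * (k + q)); last by ring.
    by exists t => //; exists (k + q).
- have m0 : 0 <= m by exact: Lsle.
  move=> x Lx; split; first exact: LP.
  move: Lx; rewrite eL => -[t + <-].
  move=> [[/L1M/=|]|/L2M/=]; try lia.
  by rewrite eLs => -[_ /=]; lia.
- move=> _ [t tP <-] tm; rewrite eL; exists t => //; left; right.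
  by rewrite eLs; split=> //=; lia.
Qed.

(** Once both ends of the central window lie in [P], the period is read off from [P] on one stretch
    of length [d] starting at [y], and the two outer parts are what [L] has outside the window. *)
Lemma AAMP_of_core (d M : nat) (L P : set int) (y m : int) :
  (0 < d)%N -> 0 <= m -> (forall x q, P x -> P (x + d%:Z * q)) ->
  P y -> P (y + m) ->
  (forall x, L x -> P x /\ y - M%:Z <= x <= y + m + M%:Z) ->
  (forall x, P x -> y <= x <= y + m -> L x) ->
  exists D, is_AAMP d M D L.
Proof.
move=> d0 m0 Pd Py Pm LP PL.
pose D : set int := [set x | P (y + x) /\ 0 <= x <= d%:Z].
have DP : periodic_set d D = [set x | P (y + x)].
  apply/seteqP; split=> x /=.
    by move=> [t [Pt _] [q ->]]; rewrite addrA; exact: Pd.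
  move=> Px; have [q qx] := int_shift x 0 d0.
  exists (x + d%:Z * q); last by exists (- q); rewrite mulrN addrK.
  by split; [rewrite addrA; exact: Pd | lia].
exists D; split.
  split=> //.
  - by rewrite /D/= addr0; split=> //; lia.
  - by rewrite /D/= -[d%:Z]mulr1; split; [exact: Pd | lia].
  - by move=> x [].
exists y, [set x | L (y + x) /\ x < 0],
  (periodic_set d D `&` [set x | 0 <= x <= m]), [set x | L (y + x) /\ m < x], m.
rewrite DP; split; last first.
  by split=> x [/LP[_] /=]; lia.
split.
- apply/seteqP; split=> [x Lx|_ [x + <-]].
    exists (x - y); last by rewrite addrC subrK.
    have [Px xy] := LP _ Lx.
    have e : y + (x - y) = x by rewrite addrC subrK.
    have [x0|x0] := ltP (x - y) 0; first by left; left; rewrite /= e.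
    have [xm|xm] := ltP m (x - y); first by right; rewrite /= e.
    by left; right; rewrite /= e; split=> //; lia.
  by move=> [[[]|[/= Px xm]]|[]] //; apply: PL => //; lia.
- move=> x /LP[Px _]; exists (x - y); last by rewrite addrC subrK.
  by rewrite /= addrC subrK.
- split=> //.
  + apply: (@sub_finite_set _ _ [set k%:Z | k in `I_(`|m|.+1)]).
      by move=> x [_ /= xm]; exists `|x|%N => /=; lia.
    exact/finite_image/finite_II.
  + by split=> [|x []/= _]; [split; [rewrite /= addr0 | rewrite /=; lia] | lia].
  + by split=> [|x []/= _]; [split=> //=; lia | lia].
Qed.

Lemma AAMP_of_loose (d M : nat) L : (0 < d)%N -> loose d M L ->
  exists D, is_AAMP d (2 * M + d) D L.
Proof.
move=> d0 [[l Ll] [P [u [v [Pd LP PL]]]]].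
have Pn x : P x -> P (x - d%:Z) by rewrite -mulrN1; exact: Pd.
have Pp x : P x -> P (x + d%:Z) by rewrite -[d%:Z]mulr1; exact: Pd.
(* If [P] meets the window, its extreme elements there serve as ends of the core. By periodicity
   they are less than [d] away from [u] and [v]. *)
have [PI|PI] := pselect ((P `&` [set x | u <= x <= v]) !=set0).
  have [|u' [Pu' /= uu'] u'min] := int_min PI (b := u).
    by move=> x [_ /=]; lia.
  have [|v' [Pv' /= vv'] v'max] := int_max PI (b := v).
    by move=> x [_ /=]; lia.
  have u'd : u' < u + d%:Z.
    have [//|h] := ltP u' (u + d%:Z).
    have : u' <= u' - d%:Z by apply: u'min; split=> /=; [exact: Pn | lia].
    by lia.
  have v'd : v - d%:Z < v'.
    have [//|h] := ltP (v - d%:Z) v'.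
    have : v' + d%:Z <= v' by apply: v'max; split=> /=; [exact: Pp | lia].
    by lia.
  apply: (@AAMP_of_core _ _ _ P u' (v' - u')) => //.
  - by have := u'min _ (conj Pv' vv'); lia.
  - by rewrite addrC subrK.
  - by move=> x /LP[Px ux]; split=> //; lia.
  - by move=> x Px ux; apply: PL => //; lia.
(* Otherwise the window is shorter than a period, since it would else contain a translate of [l].
   Then [L] has diameter below [2 * M + d], and the core is the single point [min L]. *)
have uv : v < u + d%:Z.
  have [//|h] := ltP v (u + d%:Z).
  have [q qP] := int_shift l u d0.
  case: PI; exists (l + d%:Z * q); split=> /=; last by lia.
  by apply: Pd; case: (LP _ Ll).
have [||y Ly ymin] := @int_min L (u - M%:Z).
- by exists l.
- by move=> x /LP[_]; lia.
have [Py yu] := LP _ Ly.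
apply: (@AAMP_of_core _ _ _ P y 0) => //.
- by rewrite addr0.
- by move=> x Lx; have [Px ux] := LP _ Lx; have := ymin _ Lx; split=> //; lia.
- by move=> x Px yx; rewrite (_ : x = y)//; lia.
Qed.

Definition sumset (A B : set int) : set int :=
  [set z | exists x y, [/\ A x, B y & z = x + y]].

Lemma sumsetC A B : sumset A B = sumset B A.
Proof.
by apply/seteqP; split=> _ [x [y [Ax By ->]]]; exists y, x; rewrite addrC.
Qed.

Lemma loose_sumset (d M1 M2 : nat) L1 L2 : (0 < d)%N ->
  loose d M1 L1 -> loose d M2 L2 ->
  loose d (3 * (M1 + M2) + d) (sumset L1 L2).
Proof.
move=> d0.
(* If [K2] is short, the period of the sum is [P1 + K2]. *)
have short (K1 K2 : set int) (N1 N2 : nat) (P2 : set int) (u2 v2 : int) :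
    (forall x, K2 x -> P2 x /\ u2 - N2%:Z <= x <= v2 + N2%:Z) ->
    v2 < u2 + d%:Z -> loose d N1 K1 -> loose d N2 K2 ->
    loose d (3 * (N1 + N2) + d) (sumset K1 K2).
  move=> LP2 uv2.
  move=> [[l1 Ll1] [P1 [u1 [v1 [P1d LP1 PL1]]]]] [[l2 Ll2] _]; split.
    by exists (l1 + l2), l1, l2.
  (* As [K2] lies between [u2 - N2] and [v2 + N2], a sum in this window has its first summand in
     [[u1, v1]]. *)
  exists (sumset P1 K2), (u1 + v2 + N2%:Z), (v1 + u2 - N2%:Z); split.
  - move=> _ q [x [y [Px Ly ->]]]; exists (x + d%:Z * q), y.
    by split=> //; [exact: P1d | rewrite addrAC].
  - move=> _ [x [y [Lx Ly ->]]]; have [Px ux] := LP1 _ Lx.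
    by have [_ uy] := LP2 _ Ly; split; [exists x, y | lia].
  - move=> _ [x [y [Px Ly ->]]] uxy; exists x, y; split=> //.
    by apply: PL1 => //; have [_ uy] := LP2 _ Ly; lia.
move=> l1 l2.
have [[n1 Ln1] [P1 [u1 [v1 [P1d LP1 PL1]]]]] := l1.
have [[n2 Ln2] [P2 [u2 [v2 [P2d LP2 PL2]]]]] := l2.
have [uv2|uv2] := ltP v2 (u2 + d%:Z); first exact: (short _ _ _ _ P2 u2 v2).
have [uv1|uv1] := ltP v1 (u1 + d%:Z).
  by rewrite sumsetC (addnC M1); exact: (short _ _ _ _ P1 u1 v1).
split; first by exists (n1 + n2), n1, n2.
exists (sumset P1 P2), (u1 + u2 + d%:Z), (v1 + v2 - d%:Z); split.
- move=> _ q [x [y [Px Py ->]]]; exists (x + d%:Z * q), y.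
  by split=> //; [exact: P1d | rewrite addrAC].
- move=> _ [x [y [Lx Ly ->]]]; have [Px ux] := LP1 _ Lx.
  by have [Py uy] := LP2 _ Ly; split; [exists x, y | lia].
- move=> _ [x [y [Px Py ->]]] uxy.
  (* A multiple of [d] is moved between the summands to bring both into their windows. The maximum
     encodes the lower bound for the first and the upper bound for the second; the other two bounds
     hold because both windows have length at least [d] and the window of the sum was shrunk by [d]
     at each end. *)
  have [q qP] := int_shift x (Num.max u1 (x + y - v2)) d0.
  exists (x + d%:Z * q), (y - d%:Z * q); split; last by ring.
    by apply: PL1; [exact: P1d | lia].
  by apply: PL2; [rewrite -mulrN; exact: P2d | lia].
Qed.

(** The bound [N] is chosen before the sets [L], because a single bound has to serve all elements of
    the product. *)
Lemma loose_sum (I : eqType) (r : seq I) (d M : nat) : (0 < d)%N -> uniq r ->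
  exists N, forall L : I -> set int, (forall i, loose d M (L i)) ->
    loose d N [set \sum_(i <- r) k i | k in [set k | forall i, L i (k i)]].
Proof.
move=> d0; elim: r => [_|j r IHr /= /andP[jr /IHr{IHr}[N IHr]]].
  exists 0%N => L loL.
  have [k Lk] := boolp.choice (fun i => (loL i).1).
  split; first by exists 0, k => //; rewrite big_nil.
  exists [set x | exists q, x = d%:Z * q], 0, 0; split.
  - by move=> _ q [q' ->]; exists (q' + q); rewrite mulrDr.
  - by move=> _ [k' _ <-]; rewrite big_nil; split=> //; exists 0; rewrite mulr0.
  - by move=> x _ x0; exists k => //; rewrite big_nil; lia.
exists (3 * (M + N) + d)%N => L loL.
have := loose_sumset d0 (loL j) (IHr L loL); congr (loose d _ _).
apply/seteqP; split=> [_ [x [_ [Lx [k Lk <-] ->]]]|_ [k Lk <-]]; last first.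
  by exists (k j), (\sum_(i <- r) k i); rewrite big_cons; split=> //; exists k.
(* Since [r] has no repetition, [j] is not in the tail, and changing the value at [j] leaves the
   tail sum alone. *)
exists (fun i => if i == j then x else k i).
  by move=> i; case: eqP => [->|_] //; exact: Lk.
rewrite big_cons eqxx; congr (_ + _); apply: eq_big_seq => i ir.
by case: eqP => // ij; rewrite -ij ir in jr.
Qed.

(** The shift [e] is a multiple of [d], so it preserves [P], and is at least [M], so it carries [l]
    past the irregular margin. The gap [e + M] to [k] keeps it from overshooting the window at the
    other end. *)
Lemma loose_exchange (d M : nat) L k l (e := (d * M.+1)%N) : (0 < d)%N ->
  loose d M L -> L k -> L l ->
  (k + (e + M)%N%:Z <= l -> L (l - e%:Z)) /\
  (l + (e + M)%N%:Z <= k -> L (l + e%:Z)).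
Proof.
move=> d0 [_ [P [u [v [Pd LP PL]]]]] /LP[_ ku] /LP[Pl lu].
have eM : (M <= e)%N by rewrite /e; nia.
by split=> kl; apply: PL; try lia; rewrite /e PoszM -?mulrN; exact: Pd.
Qed.

End IntegerSets.

(** * Exchange of lengths *)

Section VectorExchange.
Variable I : finType.
Implicit Types k l : I -> nat.

(** The l1-distance: with truncated subtraction one of the two terms vanishes. *)
Definition vdist k l := \sum_i ((k i - l i) + (l i - k i)).

Lemma vdistC k l : vdist k l = vdist l k.
Proof. by apply: eq_bigr => i _; rewrite addnC. Qed.

(** The positive parts of [l - k] add up to at most [#|I| * B], and the negative parts exceed them
    by exactly the difference of the sums. *)
Lemma vdist_le B k l : (forall i, l i < k i + B) ->
  vdist k l <= 2 * (#|I| * B) + (\sum_i k i - \sum_i l i).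
Proof.
move=> lk; rewrite /vdist big_split/=.
have e : \sum_i (k i - l i) + \sum_i l i = \sum_i (l i - k i) + \sum_i k i.
  by rewrite -!big_split/=; apply: eq_bigr => i _; lia.
have : \sum_i (l i - k i) <= \sum_(i : I) B.
  by apply: leq_sum => i _; have := lk i; lia.
have -> : \sum_(i : I) B = #|I| * B by rewrite sum_nat_const.
move: (\sum_i (k i - l i)) (\sum_i (l i - k i)) e (#|I| * B) => x y e c. lia.
Qed.

Definition exchangeable (e B : nat) (A : set nat) :=
  forall k l : nat, A k -> A l ->
  (k + B <= l -> A (l - e)) /\ (l + B <= k -> A (l + e)).

(** Either [l] exceeds [k] by less than [B] everywhere, or conversely, and [vdist_le] applies; or
    there are [i] with [l i] far above [k i] and [j] with [l j] far below [k j]. Then [e] is moved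
    from [l i] to [l j], and as [e <= B] neither entry crosses that of [k], so the distance drops by
    [2 * e]. *)
Lemma vector_exchange (e B : nat) (A : I -> set nat) k l : 0 < e <= B ->
  (forall i, exchangeable e B (A i)) ->
  (forall i, A i (k i)) -> (forall i, A i (l i)) ->
  vdist k l <= 2 * (#|I| * B)
               + ((\sum_i k i - \sum_i l i) + (\sum_i l i - \sum_i k i)) \/
  exists m, [/\ forall i, A i (m i), \sum_i m i = \sum_i l i,
                vdist k m < vdist k l & vdist m l <= 2 * e].
Proof.
move=> /andP[e0 eB] exA kA lA.
have [ub|/existsNP[i /negP]] := pselect (forall i, l i < k i + B).
  by left; apply: leq_trans (vdist_le ub) _; rewrite leq_add2l leq_addr.
rewrite -leqNgt => ki.
have [lb|/existsNP[j /negP]] := pselect (forall i, k i < l i + B).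
  by left; rewrite vdistC; apply: leq_trans (vdist_le lb) _;
    rewrite leq_add2l leq_addl.
rewrite -leqNgt => kj; right.
have ij : i != j by apply/eqP => ij; move: kj; rewrite -ij; lia.
pose m h := if h == i then l i - e else if h == j then l j + e else l h.
have split2 (f : I -> nat) :
    \sum_h f h = f i + (f j + \sum_(h | (h != i) && (h != j)) f h).
  by rewrite (bigD1 i)//= (bigD1 j)//= eq_sym.
have mi : m i = l i - e by rewrite /m eqxx.
have mj : m j = l j + e by rewrite /m eq_sym (negbTE ij) eqxx.
have mh h : (h != i) && (h != j) -> m h = l h.
  by rewrite /m => /andP[/negbTE-> /negbTE->].
exists m; split.
- move=> h; rewrite /m; case: eqP => [->|_].
    exact: (exA i _ _ (kA i) (lA i)).1.
  case: eqP => [->|_]; last exact: lA.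
  exact: (exA j _ _ (kA j) (lA j)).2.
- by rewrite split2 mi mj (eq_bigr l)// (split2 l); lia.
- rewrite /vdist split2 mi mj (eq_bigr (fun h => (k h - l h) + (l h - k h))).
    by rewrite [ltnRHS]split2; lia.
  by move=> h /mh ->.
- rewrite /vdist split2 mi mj big1; first lia.
  by move=> h /mh ->; lia.
Qed.

End VectorExchange.

Lemma loose_exchangeable (d M : nat) (A : set nat) : 0 < d ->
  loose d M [set k%:Z | k in A]%R ->
  exchangeable (d * M.+1) (d * M.+1 + M) A.
Proof.
move=> d0 lA k l Ak Al.
have [] := loose_exchange (k := k%:Z%R) (l := l%:Z%R) d0 lA;
  [by exists k | by exists l |].
move=> h1 h2; split=> kl.
  have [|x Ax] := h1; first lia.
  by move=> xl; rewrite (_ : _ - _ = x)//; lia.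
have [|x Ax] := h2; first lia.
by move=> xl; rewrite (_ : _ + _ = x)//; lia.
Qed.

(** * Finiteness of the invariants as existence of bounds *)

Lemma leastP (A : set nat) : least A <> None <-> exists n, A n.
Proof.
rewrite /least; case: pselect => [exA|nexA]; split=> //.
  by move=> _; case: exA => n /asboolP; exists n.
by move=> [n An]; case: nexA; exists n; apply/asboolP.
Qed.

Lemma least_in (A : set nat) : (exists n, A n) ->
  A (odflt 0 (least A)) /\ forall n, A n -> odflt 0 (least A) <= n.
Proof.
move=> [n An]; rewrite /least; case: pselect => [exA|nexA]; last first.
  by case: nexA; exists n; apply/asboolP.
case: ex_minnP => m /= /asboolP Am mmin; split=> // p Ap.
by apply: mmin; apply/asboolP.
Qed.

Section Distances.
Variable H : ucMonoidType.
Local Notation fact := {mset (red_atom H)}%mset.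
Implicit Types (a : H) (z w : fact) (X Y : set fact).

Lemma dist_xx z : dist z z = 0.
Proof. by rewrite /dist msetIid msetBxx /len size_mset0. Qed.

Lemma set_dist_ex X Y z w : X z -> Y w ->
  exists x y, [/\ X x, Y y & dist x y = set_dist X Y].
Proof.
move=> Xz Yw; rewrite /set_dist.
set A := (A in least A).
by have [|] := @least_in A; first by exists (dist z w), z, w.
Qed.

Lemma set_dist_le X Y z w : X z -> Y w -> set_dist X Y <= dist z w.
Proof.
move=> Xz Yw; rewrite /set_dist; set A := (A in least A).
have [|_] := @least_in A; first by exists (dist z w), z, w.
by apply; exists z, w.
Qed.

Definition ndist (k l : nat) := (k - l) + (l - k).

(** Finiteness of [weak_successive_distance] expressed by factorizations attaining the minimal
    distance between two length classes. *)
Definition weak_successive_bound N := forall a z z', facts a z -> facts a z' ->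
  exists w w', [/\ facts a w, facts a w', len w = len z, len w' = len z'
                 & dist w w' <= N * ndist (len z) (len z')].

Lemma weak_successive_distanceP :
  weak_successive_distance H <> None <-> exists N, weak_successive_bound N.
Proof.
rewrite leastP; split=> -[N NP]; exists N.
  move=> a z z' az az'.
  have [||x [y [[ax lx] [ay ly] xy]]] :=
    @set_dist_ex (facts_len (len z) a) (facts_len (len z') a) z z';
    try by split.
  exists x, y; split=> //; rewrite xy.
  apply: leq_trans (NP a (len z) (len z') _ _) _; [by exists z|by exists z'|].
  by rewrite leq_mul2l /ndist; lia.
move=> a k l [z az <-] [z' az' <-].
have [w [w' [aw aw' wz wz' ww']]] := NP a z z' az az'.
apply: leq_trans (leq_trans ww' _).
  by apply: set_dist_le; split.
by rewrite leq_mul2l /ndist; lia.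
Qed.

(** Chains of constant length in inductive form, suited to concatenation and to changing one
    coordinate at a time. *)
Inductive eqchain N a : fact -> fact -> Prop :=
| eqchain_refl z : eqchain N a z z
| eqchain_step x y z : facts a x -> facts a y -> len x = len y ->
    dist x y <= N -> eqchain N a y z -> eqchain N a x z.

Lemma eqchain1 N a x y : facts a x -> facts a y -> len x = len y ->
  dist x y <= N -> eqchain N a x y.
Proof. by move=> *; apply: eqchain_step (eqchain_refl _ _ _). Qed.

Lemma eqchain_trans N a x y z :
  eqchain N a x y -> eqchain N a y z -> eqchain N a x z.
Proof.
by elim=> // {}x x' {}y ax ax' e d _ IH /IH; exact: eqchain_step.
Qed.

Lemma eqchain_monotone N N' a x y : N <= N' ->
  eqchain N a x y -> eqchain N' a x y.
Proof.
move=> NN'; elim=> [z|{}x x' {}y ax ax' e d _]; first exact: eqchain_refl.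
by apply: eqchain_step => //; exact: leq_trans NN'.
Qed.

Lemma eqchain_facts N a x y : eqchain N a x y -> facts a x -> facts a y.
Proof. by elim=> // {}x x' {}y _ ax' _ _ _ IH _; exact: IH. Qed.

Lemma monotone_chain_of_eqchain N a x y :
  facts a x -> eqchain N a x y -> monotone_chain N a x y.
Proof.
move=> + xy; elim: xy => [z|{}x x' {}y ax ax' e d _ IH] az.
  by exists [::]; split=> //; [move=> w; rewrite inE => /eqP-> | left].
have [s [sP sl sd smon]] := IH ax'.
exists (x' :: s); split=> //.
- by move=> w; rewrite inE => /predU1P[->//|]; exact: sP.
- by rewrite /= d.
- by case: smon => /= smon; [left|right]; rewrite /= /geq/= e leqnn.
Qed.

(** A monotone sequence of lengths with equal ends is constant. *)
Lemma eqchain_of_monotone_chain N a x y : len x = len y ->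
  monotone_chain N a x y -> eqchain N a x y.
Proof.
(* An arbitrary order [r] covers ascending and descending chains at once. *)
have main (r : rel nat) : reflexive r -> transitive r -> antisymmetric r ->
    forall s x, len x = len (last x s) ->
    (forall z, z \in x :: s -> facts a z) ->
    path (fun x y => dist x y <= N) x s ->
    sorted r [seq len x | x <- x :: s] -> eqchain N a x (last x s).
  move=> rr rt ra; elim=> [|z s IH] {}x /=.
    by move=> *; exact: eqchain_refl.
  move=> xl sP /andP[xz sd] /andP[rxz rs].
  have zl : r (len z) (len (last z s)).
    have := order_path_min rt rs; case: (lastP s) => [//|t w].
    rewrite last_rcons map_rcons => /allP; apply.
    by rewrite mem_rcons mem_head.
  have e : len x = len z by apply: ra; rewrite rxz xl.
  have az : facts a z by apply: sP; rewrite !inE eqxx orbT.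
  apply: (@eqchain_step _ _ x z) => //; first by apply: sP; rewrite mem_head.
  apply: IH => //; first by rewrite -e.
  by move=> w ws; apply: sP; rewrite inE ws orbT.
move=> xy [s [sP sl sd smon]]; rewrite -sl in xy *.
case: smon; first exact: (main leq leqnn leq_trans anti_leq).
apply: (main geq) => //; first exact: leqnn.
- by move=> n m p nm mp; exact: leq_trans mp nm.
- by move=> n m; rewrite andbC; exact: anti_leq.
Qed.

Definition equal_catenary_bound N := forall a z z', facts a z -> facts a z' ->
  len z = len z' -> eqchain N a z z'.

Lemma equal_catenary_degreeP :
  equal_catenary_degree H <> None <-> exists N, equal_catenary_bound N.
Proof.
rewrite leastP; split=> -[N NP]; exists N => a z z' az az' zz'.
  by apply: eqchain_of_monotone_chain => //; exact: NP.
by apply: monotone_chain_of_eqchain => //; exact: NP.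
Qed.

End Distances.

Lemma structure_theoremP (K : ucMonoidType) : atomic K ->
  structure_theorem K <-> exists d M : nat, 0 < d /\
    forall a : K, loose d M [set k%:Z | k in lengths a]%R.
Proof.
move=> atK; split=> [[_ [M [Delta [/finite_seqP[s ->] _ Delta0 aP]]]]|].
  (* The product of the finitely many differences is a multiple of each, hence a common difference
     for the loose form. *)
  exists (\prod_(d <- s) d), M; split.
    by rewrite big_seq; elim/big_ind: _ => // m n m0 n0; rewrite muln_gt0 m0.
  move=> a; have [d ds [D aD]] := aP a.
  apply: (loose_dvdn (d := d)); last exact: loose_of_AAMP aD.
  by rewrite (perm_big _ (perm_to_rem ds)) big_cons dvdn_mulr.
move=> [d [M [d0 aM]]]; split=> //; exists (2 * M + d), [set d]%classic; split.
- exact: finite_set1.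
- by exists d.
- by move=> _ ->.
- by move=> a; exists d => //; exact: AAMP_of_loose.
Qed.

Lemma weak_successive_bound_monotone (K : ucMonoidType) N N' : N <= N' ->
  weak_successive_bound K N -> weak_successive_bound K N'.
Proof.
move=> NN' KN a z z' az az'.
have [w [w' [aw aw' wz wz' ww']]] := KN a z z' az az'.
by exists w, w'; split=> //; apply: leq_trans ww' _; rewrite leq_mul2r NN' orbT.
Qed.

Section FactorizationsOfOne.
Variable K : ucMonoidType.
Implicit Type z : {mset (red_atom K)}%mset.

Lemma facts1 : facts (1%g : K) mset0.
Proof. by rewrite /facts/= /fact_val big_mset0 pi_red1. Qed.

Lemma facts1_len z : facts (1%g : K) z -> len z = 0.
Proof.
rewrite /facts/= /fact_val /len pi_red1.
case: (z : seq _) => //= u s; rewrite big_cons => /red_mul_eq1.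
by have /red_atomP[] := val_atom u.
Qed.

End FactorizationsOfOne.

(** * Distances in a product *)

Section Product.
Variables (I : finType) (H : I -> ucMonoidType).
Local Notation P := (prod_monoid H).
Local Notation fact K := {mset (red_atom K)}%mset.
Implicit Types (a : P) (z : fact P) (i j : I).

Lemma facts_glue a (f : forall i, fact (H i)) :
  facts a (fact_glue f) <-> forall i, facts (a i) (f i).
Proof. by rewrite facts_proj; split=> + i => /(_ i); rewrite fact_glueK. Qed.

Lemma len_glue (f : forall i, fact (H i)) :
  len (fact_glue f) = \sum_i len (f i).
Proof. by rewrite len_proj; apply: eq_bigr => i _; rewrite fact_glueK. Qed.

Lemma fact_proj_glue z : fact_glue (fun i => fact_proj i z) = z.
Proof. by apply: fact_proj_inj => i; rewrite fact_glueK. Qed.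

Lemma lengths_prod a :
  lengths a = [set \sum_i k i | k in [set k | forall i, lengths (a i) (k i)]].
Proof.
apply/seteqP; split=> [_ [z az <-]|_ [k ak <-]].
  exists (fun i => len (fact_proj i z)); last by rewrite len_proj.
  by move=> i; exists (fact_proj i z) => //; exact: (facts_proj _ _).1.
have /fin_all_exists[f fP] i : exists w, facts (a i) w /\ len w = k i.
  by have [w] := ak i; exists w.
exists (fact_glue f); first by apply/facts_glue => i; case: (fP i).
by rewrite len_glue; apply: eq_bigr => i _; case: (fP i).
Qed.

Definition prod_inj i (b : H i) : P := finfun (dfwith (fun j => 1%g : H j) b).

Lemma prod_inj_id i (b : H i) : prod_inj b i = b.
Proof. by rewrite ffunE dfwith_in. Qed.

Lemma prod_inj_neq i j (b : H i) : i != j -> prod_inj b j = 1%g.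
Proof. by move=> ij; rewrite ffunE dfwith_out. Qed.

Definition fact_inj i (z : fact (H i)) : fact P :=
  fact_glue (dfwith (fun j => mset0 : fact (H j)) z).

Lemma fact_injK i (z : fact (H i)) : fact_proj i (fact_inj z) = z.
Proof. by rewrite fact_glueK dfwith_in. Qed.

(** The components other than [i] factor 1, so they are empty and contribute no length. *)
Lemma facts_prod_inj i (b : H i) z : facts (prod_inj b) z ->
  facts b (fact_proj i z) /\ len (fact_proj i z) = len z.
Proof.
move=> /facts_proj bz; split; first by rewrite -{1}(prod_inj_id b).
rewrite len_proj (bigD1 i)//= big1 ?addn0// => j ji.
by apply: facts1_len; rewrite -(prod_inj_neq b) ?bz// eq_sym.
Qed.

Lemma facts_fact_inj i (b : H i) (w : fact (H i)) : facts b w ->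
  facts (prod_inj b) (fact_inj w).
Proof.
move=> bw; apply/facts_glue => j; have [<-|ij] := eqVneq i j.
  by rewrite prod_inj_id dfwith_in.
by rewrite prod_inj_neq// dfwith_out//; exact: facts1.
Qed.

Lemma len_fact_inj i (b : H i) (w : fact (H i)) : facts b w ->
  len (fact_inj w) = len w.
Proof.
by move=> /facts_fact_inj/facts_prod_inj[_ <-]; rewrite fact_injK.
Qed.

Lemma lengths_prod_inj i (b : H i) : lengths (prod_inj b) = lengths b.
Proof.
apply/seteqP; split=> _ [z bz <-].
  by have [bz' <-] := facts_prod_inj bz; exists (fact_proj i z).
by exists (fact_inj z); [exact: facts_fact_inj | exact: len_fact_inj bz].
Qed.

Lemma weak_successive_bound_factor N i :
  weak_successive_bound P N -> weak_successive_bound (H i) N.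
Proof.
move=> PN b z z' bz bz'.
have [w [w' [bw bw' wz wz' ww']]] :=
  PN _ _ _ (facts_fact_inj bz) (facts_fact_inj bz').
have [bwi wi] := facts_prod_inj bw; have [bwi' wi'] := facts_prod_inj bw'.
exists (fact_proj i w), (fact_proj i w'); split=> //.
- by rewrite wi wz (len_fact_inj bz).
- by rewrite wi' wz' (len_fact_inj bz').
- rewrite -(len_fact_inj bz) -(len_fact_inj bz').
  exact: leq_trans (dist_proj_le _ _ _) ww'.
Qed.

Lemma eqchain_proj N i (b : H i) z z' : eqchain N (prod_inj b) z z' ->
  eqchain N b (fact_proj i z) (fact_proj i z').
Proof.
elim=> [w|x y w bx by_ xy dxy _]; first exact: eqchain_refl.
have [bx' xl] := facts_prod_inj bx; have [by' yl] := facts_prod_inj by_.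
apply: eqchain_step => //; first by rewrite xl yl.
exact: leq_trans (dist_proj_le _ _ _) dxy.
Qed.

Lemma equal_catenary_bound_factor N i :
  equal_catenary_bound P N -> equal_catenary_bound (H i) N.
Proof.
move=> PN b z z' bz bz' zz'.
rewrite -[z]fact_injK -[z']fact_injK; apply: eqchain_proj.
apply: PN; [exact: facts_fact_inj|exact: facts_fact_inj|].
by rewrite (len_fact_inj bz) (len_fact_inj bz').
Qed.

Lemma eqchain_glue_dfwith N a (f : forall i, fact (H i)) j (x y : fact (H j)) :
  (forall i, facts (a i) (f i)) -> facts (a j) x -> eqchain N (a j) x y ->
  eqchain N a (fact_glue (dfwith f x)) (fact_glue (dfwith f y)).
Proof.
move=> af + xy; elim: xy => [w|{}x w {}y ax aw xl xw _ IH] _.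
  exact: eqchain_refl.
have adf (u : fact (H j)) : facts (a j) u -> facts a (fact_glue (dfwith f u)).
  move=> au; apply/facts_glue => i; have [<-|ji] := eqVneq j i.
    by rewrite dfwith_in.
  by rewrite dfwith_out.
apply: (eqchain_step (adf x ax) (adf w aw)); last exact: IH.
  rewrite !len_glue; apply: eq_bigr => i _; have [<-|ji] := eqVneq j i.
    by rewrite !dfwith_in.
  by rewrite !dfwith_out.
apply: leq_trans (dist_le_sum _ _) _; rewrite (bigD1 j)//= big1 => [|i ij].
  by rewrite addn0 !fact_glueK !dfwith_in.
by rewrite !fact_glueK !dfwith_out 1?eq_sym// dist_xx.
Qed.

(** The coordinates are changed one after the other, so each step moves within a single factor and
    the bound [N] does not grow with the number of factors. *)
Lemma eqchain_glue N a (f g : forall i, fact (H i)) :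
  (forall i, facts (a i) (f i)) ->
  (forall i, eqchain N (a i) (f i) (g i)) ->
  eqchain N a (fact_glue f) (fact_glue g).
Proof.
move=> af fg.
have ag i : facts (a i) (g i) by exact: eqchain_facts (fg i) (af i).
(* The intermediate [h] agrees with [g] on the coordinates already treated and with [f] on the
   others. *)
suff [h [hg _ fh]] : exists h : forall i, fact (H i),
    [/\ forall i, i \in enum I -> h i = g i,
        forall i, i \notin enum I -> h i = f i
      & eqchain N a (fact_glue f) (fact_glue h)].
  rewrite (_ : fact_glue g = fact_glue h)//.
  by apply: fact_proj_inj => i; rewrite !fact_glueK hg// mem_enum.
elim: (enum I) => [|j r [h [hg hf fh]]].
  by exists f; split=> //; exact: eqchain_refl.
have ah i : facts (a i) (h i).
  by have [/hg->|/hf->] := boolP (i \in r).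
exists (dfwith h (g j)); split.
- move=> i; rewrite inE; have [->|ij] := eqVneq i j; first by rewrite dfwith_in.
  by rewrite dfwith_out 1?eq_sym//; exact: hg.
- move=> i; rewrite inE negb_or => /andP[ij ir].
  by rewrite dfwith_out 1?eq_sym//; exact: hf.
- apply: (eqchain_trans fh).
  rewrite (_ : fact_glue h = fact_glue (dfwith h (h j))); last first.
    apply: fact_proj_inj => i; rewrite !fact_glueK.
    have [<-|ji] := eqVneq j i; first by rewrite dfwith_in.
    by rewrite dfwith_out.
  apply: eqchain_glue_dfwith => //.
  by have [/hg->|/hf->] := boolP (j \in r); [exact: eqchain_refl | exact: fg].
Qed.

Definition len_vector z i := len (fact_proj i z).

Lemma len_vectorE z : len z = \sum_i len_vector z i.
Proof. exact: len_proj. Qed.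

Lemma lengths_len_vector a z i : facts a z -> lengths (a i) (len_vector z i).
Proof. by move=> /facts_proj az; exists (fact_proj i z). Qed.

Lemma facts_of_len_vector a (k : I -> nat) : (forall i, lengths (a i) (k i)) ->
  exists2 z, facts a z & len_vector z = k.
Proof.
move=> ak.
have /fin_all_exists[f fP] i : exists w, facts (a i) w /\ len w = k i.
  by have [w] := ak i; exists w.
exists (fact_glue f); first by apply/facts_glue => i; case: (fP i).
by apply/funext => i; rewrite /len_vector fact_glueK; case: (fP i).
Qed.

Lemma weak_successive_vector N a z z' :
  (forall i, weak_successive_bound (H i) N) -> facts a z -> facts a z' ->
  exists w w', [/\ facts a w, facts a w',
    len_vector w = len_vector z, len_vector w' = len_vector z'
    & dist w w' <= N * vdist (len_vector z) (len_vector z')].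
Proof.
move=> HN /facts_proj az /facts_proj az'.
have /fin_all_exists[w /fin_all_exists[w' wP]] i :=
  HN i (a i) (fact_proj i z) (fact_proj i z') (az i) (az' i).
exists (fact_glue w), (fact_glue w'); split.
- by apply/facts_glue => i; case: (wP i).
- by apply/facts_glue => i; case: (wP i).
- by apply/funext => i; rewrite /len_vector fact_glueK; case: (wP i).
- by apply/funext => i; rewrite /len_vector fact_glueK; case: (wP i).
- apply: leq_trans (dist_le_sum _ _) _; rewrite big_distrr/=.
  by apply: leq_sum => i _; rewrite !fact_glueK; case: (wP i).
Qed.

Lemma eqchain_same_len_vector N a z z' :
  (forall i, equal_catenary_bound (H i) N) -> facts a z -> facts a z' ->
  len_vector z = len_vector z' -> eqchain N a z z'.
Proof.
move=> HN /facts_proj az /facts_proj az' /funeqP zz'.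
rewrite -(fact_proj_glue z) -(fact_proj_glue z').
by apply: eqchain_glue => // i; apply: HN => //; exact: zz'.
Qed.

(** The chain has three legs: from [z] to [w] with fixed length vector, one jump from [w] to [w'] of
    distance at most [W * C], and from [w'] to [z'] again with fixed length vector. *)
Lemma eqchain_vdist N W C a z z' :
  (forall i, equal_catenary_bound (H i) N) ->
  (forall i, weak_successive_bound (H i) W) ->
  facts a z -> facts a z' -> len z = len z' ->
  vdist (len_vector z) (len_vector z') <= C -> eqchain (N + W * C) a z z'.
Proof.
move=> HN HW az az' zz' zz'C.
have [w [w' [aw aw' wz wz' ww']]] := weak_successive_vector HW az az'.
have le1 : N <= N + W * C by rewrite leq_addr.
apply: (@eqchain_trans _ _ _ _ w).
  by apply: eqchain_monotone le1 _; apply: eqchain_same_len_vector.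
apply: (@eqchain_trans _ _ _ _ w').
  apply: eqchain1 => //.
    by rewrite len_vectorE wz len_vectorE wz' -!len_vectorE.
  apply: leq_trans ww' _; apply: leq_trans (leq_addl _ _).
  by rewrite leq_mul2l zz'C orbT.
by apply: eqchain_monotone le1 _; apply: eqchain_same_len_vector.
Qed.

Lemma equal_catenary_bound_prod (e B N W : nat) : 0 < e <= B ->
  (forall a i, exchangeable e B (lengths (a i))) ->
  (forall i, equal_catenary_bound (H i) N) ->
  (forall i, weak_successive_bound (H i) W) ->
  equal_catenary_bound P (N + W * (2 * (#|I| * B) + 2 * e)).
Proof.
(* Induction on the distance of the length vectors, with [z] fixed and [z'] replaced by an exchanged
   [y]. An exchange costs [2 * e]; when none is possible, the remaining distance is at most
   [2 * (#|I| * B)]. *)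
move=> eB ex HN HW a z z' az; have [n] := ubnP (vdist (len_vector z) (len_vector z')).
elim: n z' => // n IH z' zz'n az' zz'.
have := vector_exchange eB (ex a) (fun i => lengths_len_vector i az)
  (fun i => lengths_len_vector i az').
rewrite -!len_vectorE zz' subnn !addn0 => -[le|[m [am mz' zm mz]]].
  by apply: eqchain_vdist => //; apply: leq_trans le _; exact: leq_addr.
have [y ay ym] := facts_of_len_vector am; subst m.
rewrite -!len_vectorE in mz'.
apply: (@eqchain_trans _ _ _ _ y).
  by apply: IH => //; [exact: leq_trans zm _ | rewrite mz'].
by apply: eqchain_vdist => //; apply: leq_trans mz _; exact: leq_addl.
Qed.

(** Exchanges are repeated until none is possible; they keep only the total length of [z'], which is
    all that the weak successive distance requires. *)
Lemma near_len_vector (e B : nat) a z z' : 0 < e <= B ->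
  (forall i, exchangeable e B (lengths (a i))) ->
  facts a z -> facts a z' ->
  exists y, [/\ facts a y, len y = len z' &
    vdist (len_vector z) (len_vector y) <=
      2 * (#|I| * B) + ndist (len z) (len z')].
Proof.
move=> eB ex az; have [n] := ubnP (vdist (len_vector z) (len_vector z')).
elim: n z' => // n IH z' zz'n az'.
have := vector_exchange eB ex (fun i => lengths_len_vector i az)
  (fun i => lengths_len_vector i az').
rewrite -!len_vectorE => -[le|[m [am mz' zm mz]]]; first by exists z'.
have [y ay ym] := facts_of_len_vector am; subst m.
rewrite -!len_vectorE in mz'.
have [|//|x [ax xy zx]] := IH y; first exact: leq_trans zm _.
by exists x; rewrite -mz'.
Qed.

Lemma weak_successive_bound_prod (e B W : nat) : 0 < e <= B ->
  (forall a i, exchangeable e B (lengths (a i))) ->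
  (forall i, weak_successive_bound (H i) W) ->
  weak_successive_bound P (W * (2 * (#|I| * B)).+1).
Proof.
move=> eB ex HW a z z' az az'.
have [zz'|zz'] := eqVneq (len z) (len z').
  by exists z, z; split=> //; rewrite dist_xx.
have [y [ay yz' zy]] := near_len_vector eB (ex a) az az'.
have [w [w' [aw aw' wz wy ww']]] := weak_successive_vector HW az ay.
exists w, w'; split=> //.
- by rewrite !len_vectorE wz.
- by rewrite -yz' !len_vectorE wy.
apply: leq_trans ww' _; rewrite -mulnA leq_mul2l; apply/orP; right.
apply: leq_trans zy _; rewrite mulSn addnC leq_add2l.
(* The lengths differ here, so [ndist] is at least 1 and absorbs the additive constant
   [2 * (#|I| * B)] into the factor. *)
by rewrite leq_pmulr// /ndist; lia.
Qed.

End Product.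

(** * Length sets of the product and the equivalence *)

Lemma sum_Posz (J : Type) (r : seq J) (k : J -> nat) :
  ((\sum_(i <- r) k i)%N%:Z = \sum_(i <- r) (k i)%:Z :> int)%R.
Proof. exact: (big_morph Posz PoszD). Qed.

Lemma loose_lengths_prod (I : finType) (H : I -> ucMonoidType) (d M : nat) :
  0 < d -> (forall i (b : H i), loose d M [set k%:Z | k in lengths b]%R) ->
  exists N, forall a : prod_monoid H, loose d N [set k%:Z | k in lengths a]%R.
Proof.
move=> d0 HM; have [N NP] := loose_sum M d0 (index_enum_uniq I).
exists N => a; have := NP _ (fun i => HM i (a i)); congr (loose d N _).
rewrite lengths_prod; apply/seteqP; split=> [_ [k ak <-]|_ [_ [k ak <-] <-]].
  have [l lP] := boolp.choice (fun i =>
    let: ex_intro2 m am mk := ak i in ex_intro _ m (conj am mk)).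
  exists (\sum_i l i); first by exists l => // i; case: (lP i).
  by rewrite sum_Posz; apply: eq_bigr => i _; case: (lP i).
exists (fun i => (k i)%:Z%R); first by move=> i; exists (k i).
by rewrite sum_Posz.
Qed.

Theorem theorem3p8 (n : nat) (H : 'I_n -> ucMonoidType) :
  0 < n -> (forall i, atomic (H i)) ->
  (structure_theorem (prod_monoid H)
     /\ equal_catenary_degree (prod_monoid H) <> None
     /\ weak_successive_distance (prod_monoid H) <> None)
  <->
  (forall i : 'I_n,
     structure_theorem (H i)
     /\ equal_catenary_degree (H i) <> None
     /\ weak_successive_distance (H i) <> None).
Proof.
move=> _ atH; split=> [[PS [/equal_catenary_degreeP[N PN]
    /weak_successive_distanceP[W PW]]] i|HP].
  have [d [M [d0 aM]]] := (structure_theoremP PS.1).1 PS.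
  split.
    apply/(structure_theoremP (atH i)); exists d, M; split=> // b.
    by rewrite -lengths_prod_inj; exact: aM.
  split; [apply/equal_catenary_degreeP | apply/weak_successive_distanceP].
    by exists N; exact: equal_catenary_bound_factor.
  by exists W; exact: weak_successive_bound_factor.
have /fin_all_exists[d /fin_all_exists[M dM]] i :=
  (structure_theoremP (atH i)).1 (HP i).1.
have /fin_all_exists[N NP] i := (equal_catenary_degreeP (H i)).1 (HP i).2.1.
have /fin_all_exists[W WP] i := (weak_successive_distanceP (H i)).1 (HP i).2.2.
(* A common difference and a common bound for all factors. *)
pose D := \prod_i d i; pose m := \max_i M i.
have D0 : 0 < D by rewrite prodn_gt0// => i; case: (dM i).
have loH i (b : H i) : loose D m [set k%:Z | k in lengths b]%R.
  apply: (loose_monotone (leq_bigmax i)); apply: (@loose_dvdn (d i)).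
    by rewrite /D (bigD1 i)//= dvdn_mulr.
  exact: (dM i).2.
have ex (a : prod_monoid H) i :
    exchangeable (D * m.+1) (D * m.+1 + m) (lengths (a i)).
  exact: loose_exchangeable.
have e0 : 0 < D * m.+1 <= D * m.+1 + m by rewrite muln_gt0 D0 leq_addr.
have HN i : equal_catenary_bound (H i) (\max_i N i).
  move=> a z z' az az' zz'; apply: (eqchain_monotone (leq_bigmax i)).
  exact: NP.
have HW i : weak_successive_bound (H i) (\max_i W i).
  exact: weak_successive_bound_monotone (leq_bigmax i) (WP i).
(* Length sets of the factors are nonempty by [loose], so factorizations of the components exist and
   can be glued. *)
have atP : atomic (prod_monoid H).
  apply: atomic_of_facts => a.
  have /fin_all_exists[f fP] i : exists z, facts (a i) z.
    by have [_ [_ [z az _] _]] := (loH i (a i)).1; exists z.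
  by exists (fact_glue f); apply/facts_glue.
split; first apply/structure_theoremP => //.
  by have [N' N'P] := loose_lengths_prod D0 loH; exists D, N'.
split; [apply/equal_catenary_degreeP | apply/weak_successive_distanceP].
  by eexists; exact: equal_catenary_bound_prod e0 ex HN HW.
by eexists; exact: weak_successive_bound_prod e0 ex HW.
Qed.
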